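(* Let $f:\mathbb{R}_D\to\mathbb{R}_D$ be pointwise continuous, locally nonconstant and equipped with a structure of lifting locators, and let $a<b$ be real numbers equipped with locators such that $f(a)\leq0\leq f(b)$. Then one can construct $x:\mathbb{R}_D$ with $f(x)=0$, together with a locator for $x$.
   Context: Work in Martin-Löf type theory with propositional truncation, function extensionality and propositional extensionality. A Dedekind real is a pair $x=(L,U)$ of proposition-valued predicates on $\mathbb{Q}$, writing $q<x$ for $q\in L$ and $x<r$ for $r\in U$, which is bounded, rounded, transitive and located ($q<r\Rightarrow\|(q<x)+(x<r)\|$). $\mathbb{R}_D$ is the type of Dedekind reals, with $x<y:=\exists_{q:\mathbb{Q}}x<q<y$, $x\le y:=\neg(y<x)$ and apartness $x\mathrel{\#}y:=(x<y)\lor(y<x)$. $f$ is pointwise continuous if for all $x$: $\forall\varepsilon:\mathbb{Q}_+\exists\delta:\mathbb{Q}_+\forall y.\,|x-y|<\delta\Rightarrow|f(x)-f(y)|<\varepsilon$. $f$ is locally nonconstant if for all $x<y$ and $t:\mathbb{R}_D$ there exists $z$ with $x<z<y$ and $f(z)\mathrel{\#}t$. A locator for $x$ is a function $\prod_{q,r:\mathbb{Q}}(q<r)\to(q<x)+(x<r)$ into the untruncated disjoint sum; $f$ lifts locators if it is equipped with an element of $\prod_{x:\mathbb{R}_D}\operatorname{locator}(x)\to\operatorname{locator}(f(x))$. *)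

(* Defs.v *)
From HB Require Import structures.
From mathcomp Require Import all_boot all_order all_algebra.
From mathcomp Require Import ring lra.

Set Implicit Arguments.
Unset Strict Implicit.
Unset Printing Implicit Defensive.

Import Order.TTheory GRing.Theory Num.Theory.
Local Open Scope ring_scope.

(* [Prop] plays the role of the type of propositions: [exists] and [\/] are the
   truncated connectives, while [sumbool] and [sigT] are the untruncated ones.
   [L q] reads q < x and [U r] reads x < r. *)
Record is_dedekind (L U : rat -> Prop) : Prop := IsDedekind {
  cut_bounded : (exists q, L q) /\ (exists r, U r);
  cut_rounded : (forall q, L q <-> exists q', q < q' /\ L q') /\
                (forall r, U r <-> exists r', r' < r /\ U r');
  cut_transitive : forall q r, L q -> U r -> q < r;
  cut_located : forall q r, q < r -> L q \/ U r
}.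

Record dreal := DReal {
  lcut : rat -> Prop;
  ucut : rat -> Prop;
  dreal_cut : is_dedekind lcut ucut
}.

Definition dlt (x y : dreal) : Prop := exists q : rat, ucut x q /\ lcut y q.
Definition dle (x y : dreal) : Prop := ~ dlt y x.
Definition dapart (x y : dreal) : Prop := dlt x y \/ dlt y x.

Section CutFacts.
Variable x : dreal.

Lemma lcut_round q : lcut x q -> exists q', q < q' /\ lcut x q'.
Proof. by move/(proj1 (cut_rounded (dreal_cut x))). Qed.

Lemma ucut_round r : ucut x r -> exists r', r' < r /\ ucut x r'.
Proof. by move/(proj2 (cut_rounded (dreal_cut x))). Qed.

Lemma lcut_lt q q' : q < q' -> lcut x q' -> lcut x q.
Proof.
by move=> h Lq'; apply/(proj1 (cut_rounded (dreal_cut x))); exists q'.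
Qed.

Lemma ucut_lt r r' : r' < r -> ucut x r' -> ucut x r.
Proof.
by move=> h Ur'; apply/(proj2 (cut_rounded (dreal_cut x))); exists r'.
Qed.

Lemma cut_lt q r : lcut x q -> ucut x r -> q < r.
Proof. exact: (cut_transitive (dreal_cut x)). Qed.

Lemma cut_locate q r : q < r -> lcut x q \/ ucut x r.
Proof. exact: (cut_located (dreal_cut x)). Qed.

Lemma cut_tight e : 0 < e -> exists s, lcut x s /\ ucut x (s + e).
Proof.
move=> e0; have [[q0 Lq0] [r0 Ur0]] := cut_bounded (dreal_cut x).
have step n : forall q, lcut x q -> ucut x (q + n%:R * (e / 2)) ->
    exists s, lcut x s /\ ucut x (s + e).
  elim: n => [|n IHn] q Lq Uq.
    by have := cut_lt Lq Uq; rewrite mul0r addr0 ltxx.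
  have [Lq'|Uq'] : lcut x (q + e / 2) \/ ucut x (q + e).
  - by apply: cut_locate; lra.
  - apply: IHn Lq' _; move: Uq; rewrite -natr1; congr ucut; ring.
  - by exists q.
have d0 : 0 < e / 2 by lra.
have le0 : 0 <= (r0 - q0) / (e / 2).
  by rewrite divr_ge0 ?(ltW d0) // subr_ge0 ltW // cut_lt.
apply: (step (Num.bound ((r0 - q0) / (e / 2))) q0 Lq0).
apply: ucut_lt Ur0; have := archi_boundP le0.
by rewrite ltr_pdivrMr // => h; lra.
Qed.

End CutFacts.

Section OfRat.
Variable p : rat.

Fact drat_cut : is_dedekind (fun q => q < p) (fun r => p < r).
Proof.
split.
- by split; [exists (p - 1) | exists (p + 1)]; lra.
- split=> q; split.
  + by move=> h; exists ((q + p) / 2); split; lra.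
  + by case=> q' [h1 h2]; apply: lt_trans h1 h2.
  + by move=> h; exists ((q + p) / 2); split; lra.
  + by case=> q' [h1 h2]; apply: lt_trans h2 h1.
- by move=> q r; apply: lt_trans.
- by move=> q r qr; case: (ltP q p) => h; [left | right; apply: le_lt_trans qr].
Qed.

Definition drat : dreal := DReal drat_cut.

End OfRat.

Section Opp.
Variable x : dreal.

Fact dopp_cut : is_dedekind (fun q => ucut x (- q)) (fun r => lcut x (- r)).
Proof.
have [[q0 Lq0] [r0 Ur0]] := cut_bounded (dreal_cut x).
split.
- by split; [exists (- r0) | exists (- q0)]; rewrite opprK.
- split=> q; split.
  + by case/ucut_round=> r [h Ur]; exists (- r); rewrite opprK; split=> //; lra.
  + by case=> q' [h]; apply: ucut_lt; lra.
  + by case/lcut_round=> r [h Lr]; exists (- r); rewrite opprK; split=> //; lra.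
  + by case=> q' [h]; apply: lcut_lt; lra.
- by move=> q r Uq Lr; have := cut_lt Lr Uq; lra.
- move=> q r qr; have [|L|U] := @cut_locate x (- r) (- q); first by lra.
  + by right.
  + by left.
Qed.

Definition dopp : dreal := DReal dopp_cut.

End Opp.

Section AddMax.
Variables x y : dreal.

Fact dadd_cut : is_dedekind
  (fun q => exists s t : rat, [/\ q = s + t, lcut x s & lcut y t])
  (fun r => exists s t : rat, [/\ r = s + t, ucut x s & ucut y t]).
Proof.
have [[q1 Lq1] [r1 Ur1]] := cut_bounded (dreal_cut x).
have [[q2 Lq2] [r2 Ur2]] := cut_bounded (dreal_cut y).
split.
- by split; [exists (q1 + q2), q1, q2 | exists (r1 + r2), r1, r2].
- split=> q; split.
  + case=> s [t [-> /lcut_round[s' [h Ls']] Lt]].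
    by exists (s' + t); split; [lra | exists s', t].
  + case=> q' [h [s [t [Eq' Ls Lt]]]].
    exists (s - (q' - q)), t; split=> //; first by lra.
    by apply: lcut_lt Ls; lra.
  + case=> s [t [-> /ucut_round[s' [h Us']] Ut]].
    by exists (s' + t); split; [lra | exists s', t].
  + case=> q' [h [s [t [Eq' Us Ut]]]].
    exists (s + (q - q')), t; split=> //; first by lra.
    by apply: ucut_lt Us; lra.
- move=> q r [s [t [-> Ls Lt]]] [s' [t' [-> Us' Ut']]].
  by have := cut_lt Ls Us'; have := cut_lt Lt Ut'; lra.
- move=> q r qr.
  have [|s [Ls Us]] := @cut_tight x ((r - q) / 2); first by lra.
  have [|L|U] := @cut_locate y (q - s) (r - (s + (r - q) / 2)); first by lra.
  + by left; exists s, (q - s); split=> //; lra.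
  + by right; exists (s + (r - q) / 2), (r - (s + (r - q) / 2)); split=> //; lra.
Qed.

Definition dadd : dreal := DReal dadd_cut.

Fact dmax_cut : is_dedekind
  (fun q => lcut x q \/ lcut y q) (fun r => ucut x r /\ ucut y r).
Proof.
have [[q1 Lq1] [r1 Ur1]] := cut_bounded (dreal_cut x).
have [[q2 Lq2] [r2 Ur2]] := cut_bounded (dreal_cut y).
split.
- split; first by exists q1; left.
  have [le12|/ltW le21] := leP r1 r2.
  + have h1 : r1 < r2 + 1 by lra.
    have h2 : r2 < r2 + 1 by lra.
    by exists (r2 + 1); split; [exact: ucut_lt h1 Ur1 | exact: ucut_lt h2 Ur2].
  + have h1 : r1 < r1 + 1 by lra.
    have h2 : r2 < r1 + 1 by lra.
    by exists (r1 + 1); split; [exact: ucut_lt h1 Ur1 | exact: ucut_lt h2 Ur2].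
- split=> q; split.
  + case=> /lcut_round[q' [h L]]; exists q'; split=> //; first by left.
    by right.
  + by case=> q' [h [L|L]]; [left | right]; apply: lcut_lt L.
  + case=> /ucut_round[s [hs Us]] /ucut_round[t [ht Ut]].
    exists (Num.max ((s + q) / 2) ((t + q) / 2)); split.
      by rewrite gt_max; apply/andP; split; lra.
    split; [apply: ucut_lt Us | apply: ucut_lt Ut]; rewrite lt_max.
      by apply/orP; left; lra.
    by apply/orP; right; lra.
  + by case=> q' [h [U1 U2]]; split; [apply: ucut_lt U1 | apply: ucut_lt U2].
- by move=> q r [L|L] [U1 U2]; [apply: cut_lt L U1 | apply: cut_lt L U2].
- move=> q r qr; have [L|U1] := cut_locate x qr; first by left; left.
  by have [L|U2] := cut_locate y qr; [left; right | right].
Qed.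

Definition dmax : dreal := DReal dmax_cut.

End AddMax.

Definition dsub (x y : dreal) : dreal := dadd x (dopp y).
Definition dabs (x : dreal) : dreal := dmax x (dopp x).

Definition pointwise_continuous (f : dreal -> dreal) : Prop :=
  forall (x : dreal) (e : rat), 0 < e ->
  exists d : rat, 0 < d /\
  forall y : dreal, ucut (dabs (dsub x y)) d ->
    ucut (dabs (dsub (f x) (f y))) e.

Definition locally_nonconstant (f : dreal -> dreal) : Prop :=
  forall x y t : dreal, dlt x y ->
  exists z : dreal, [/\ dlt x z, dlt z y & dapart (f z) t].

Definition locator (x : dreal) : Type :=
  forall q r : rat, q < r -> {lcut x q} + {ucut x r}.

Definition lifts_locators (f : dreal -> dreal) : Type :=
  forall x : dreal, locator x -> locator (f x).

(* Main.v *)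
Require Import Defs.
From Stdlib Require Import ClassicalFacts FunctionalExtensionality.
From Stdlib Require Import PropExtensionality.
From mathcomp Require Import all_boot all_order all_algebra.
From mathcomp Require Import ring lra.

Set Implicit Arguments.
Unset Strict Implicit.
Unset Printing Implicit Defensive.

Import Order.TTheory GRing.Theory Num.Theory.
Local Open Scope ring_scope.

(** The root is approximated by trisection.  A bracket consists of reals
    [u < v] with locators such that [f u <= 0 <= f v], enclosed in a rational
    interval [(s, t)].  The locators of [u] and [v] decide whether the outer
    third of [(s, t)] on either side can be dropped; if neither can, then
    [u < p < q < v] for explicit rationals [p < q], and local nonconstancy with
    continuity yields a rational [z] in [(p, q)] with [f z # 0].  Since [f z]
    has a locator, such a [z] together with the sign of [f z] is found by a
    decidable search over the rationals, so the choice of [z] uses no choice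
    principle.  The enclosing rational intervals converge to a real with a
    locator, and continuity excludes that [f] is positive or negative there.

    The proof is constructive: function and propositional extensionality are
    used only to turn equivalence of cuts into equality of Dedekind reals. *)

(** * Extensional equality of cuts and comparison with zero *)

Lemma dreal_ext (x y : dreal) :
  (forall q, lcut x q <-> lcut y q) -> (forall q, ucut x q <-> ucut y q) -> x = y.
Proof.
case: x y => [L U c] [L' U' c'] /= eqL eqU.
have EL : L = L'.
  by apply: functional_extensionality => q; apply: propositional_extensionality.
have EU : U = U'.
  by apply: functional_extensionality => q; apply: propositional_extensionality.
subst L' U'; congr DReal.
(* Propositional extensionality implies proof irrelevance, which identifies the two proofs of
   [is_dedekind]. *)
exact: (ext_prop_dep_proof_irrel_cic propositional_extensionality).
Qed.

Lemma drat_locator (p : rat) : locator (drat p).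
Proof.
move=> q r qr; case: (ltP q p) => h; first by left.
by right; apply: le_lt_trans qr.
Qed.

Lemma dlt_drat0_lcut (x : dreal) : lcut x 0 -> dlt (drat 0) x.
Proof. by case/lcut_round=> q [q0 Lq]; exists q. Qed.

Lemma dlt_ucut_drat0 (x : dreal) : ucut x 0 -> dlt x (drat 0).
Proof. by case/ucut_round=> q [q0 Uq]; exists q. Qed.

Lemma eq_drat0 (x : dreal) : ~ lcut x 0 -> ~ ucut x 0 -> x = drat 0.
Proof.
move=> nL nU; apply: dreal_ext => q /=; split.
- move=> Lq; rewrite ltNge; apply/negP; rewrite le_eqVlt => /orP[/eqP E|q0].
    by apply: nL; rewrite E.
  by apply: nL; apply: lcut_lt Lq.
- by move=> q0; have [//|U0] := cut_locate x q0.
- move=> Uq; rewrite ltNge; apply/negP; rewrite le_eqVlt => /orP[/eqP E|q0].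
    by apply: nU; rewrite -E.
  by apply: nU; apply: ucut_lt Uq.
- by move=> q0; have [L0|//] := cut_locate x q0.
Qed.

(** * Distance estimates in terms of cuts *)

Section Closeness.
Variables x y : dreal.

Lemma close_lcut (e q : rat) :
  ucut (dabs (dsub x y)) e -> lcut x q -> lcut y (q - e).
Proof.
case=> -[s [t [-> Us /= Lt]]] _ Lq; apply: lcut_lt Lt.
by have := cut_lt Lq Us; lra.
Qed.

Lemma close_ucut (e q : rat) :
  ucut (dabs (dsub x y)) e -> ucut x q -> ucut y (q + e).
Proof.
case=> _ [s [t [E Ls /= Ut]]] Uq; apply: ucut_lt Ut.
by have := cut_lt Ls Uq; lra.
Qed.

Lemma close_in_interval (s t d : rat) : t - s < d ->
  lcut x s -> ucut x t -> lcut y s -> ucut y t -> ucut (dabs (dsub x y)) d.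
Proof.
move=> std Lxs Uxt Lys Uyt; split.
- exists t, (d - t); split=> //=; first by ring.
  by apply: lcut_lt Lys; lra.
- exists s, (- d - s); split=> //=; first by ring.
  by apply: ucut_lt Uyt; lra.
Qed.

End Closeness.

(** * Locators as decidable queries *)

Section Locators.
Variables (x : dreal) (l : locator x).

(** The answer of the locator as a boolean, so that it can drive a search over the rationals. The
    default [false] for [r <= q] is harmless, since only the answer [true] certifies [lcut x q]
    without assuming [q < r]. *)
Definition located_below (q r : rat) : bool :=
  if decP (@idP (q < r)) is left qr then (if l qr then true else false)
  else false.

Lemma located_below_lcut q r : located_below q r -> lcut x q.
Proof. by rewrite /located_below; case: decP => // qr; case: (l qr). Qed.

Lemma lcut_located_below q r : q < r -> lcut x r -> located_below q r.
Proof.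
rewrite /located_below; case: decP => // qr _ Lr; case: (l qr) => // Ur.
by have := cut_lt Lr Ur; rewrite ltxx.
Qed.

Lemma not_located_below_ucut q r : q < r -> ~~ located_below q r -> ucut x r.
Proof. by rewrite /located_below; case: decP => // qr _; case: (l qr). Qed.

Lemma ucut_not_located_below q r : ucut x q -> ~~ located_below q r.
Proof.
move=> Uq; apply/negP => /located_below_lcut Lq.
by have := cut_lt Lq Uq; rewrite ltxx.
Qed.

(** Boundedness gives only truncated existence. Once it is restated with a boolean predicate on the
    countable type [rat], [xchoose] extracts a witness. *)
Lemma locator_lower_bound : {q : rat | lcut x q}.
Proof.
have ex : exists q : rat, located_below q (q + 1).
  have [[q Lq] _] := cut_bounded (dreal_cut x).
  by exists (q - 1); apply: lcut_located_below; [lra | rewrite subrK].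
by exists (xchoose ex); apply: located_below_lcut (xchooseP ex).
Qed.

Lemma locator_upper_bound : {r : rat | ucut x r}.
Proof.
have ex : exists r : rat, ~~ located_below (r - 1) r.
  have [_ [r Ur]] := cut_bounded (dreal_cut x).
  by exists (r + 1); rewrite addrK; apply: ucut_not_located_below.
by exists (xchoose ex); apply: not_located_below_ucut (xchooseP ex); lra.
Qed.

End Locators.

(** * Rational points where [f] is apart from zero *)

Section Root.
Variables (f : dreal -> dreal) (f_cont : pointwise_continuous f).

Lemma continuous_pos (x : dreal) : lcut (f x) 0 ->
  exists d, 0 < d /\ forall y, ucut (dabs (dsub x y)) d -> lcut (f y) 0.
Proof.
case/lcut_round=> e [e0 Le]; have [d [d0 fd]] := f_cont x e0.
by exists d; split=> // y /fd /close_lcut /(_ Le); rewrite subrr.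
Qed.

Lemma continuous_neg (x : dreal) : ucut (f x) 0 ->
  exists d, 0 < d /\ forall y, ucut (dabs (dsub x y)) d -> ucut (f y) 0.
Proof.
case/ucut_round=> e [e0 Ue].
have [|d [d0 fd]] := f_cont x (e := - e); first by lra.
by exists d; split=> // y /fd /close_ucut /(_ Ue); rewrite subrr.
Qed.

Lemma rational_approx (p q : rat) (z : dreal) (d : rat) :
  lcut z p -> ucut z q -> 0 < d ->
  exists w : rat, p < w < q /\ ucut (dabs (dsub z (drat w))) d.
Proof.
move=> Lp Uq d0; have d20 : 0 < d / 2 by lra.
have [s [Ls Us]] := cut_tight z d20.
have sq := cut_lt Ls Uq; have ps := cut_lt Lp Us.
(* Intersecting [(p, q)] with a tight enclosure of [z] gives an interval still containing [z]; its
   midpoint serves as [w]. *)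
pose s' := Num.max p s; pose t' := Num.min q (s + d / 2).
have Ls' : lcut z s' by rewrite /s'; case: leP.
have Ut' : ucut z t' by rewrite /t'; case: leP.
have s't' := cut_lt Ls' Ut'.
have ps' : p <= s' by rewrite le_max lexx.
have ss' : s <= s' by rewrite le_max lexx orbT.
have t'q : t' <= q by rewrite ge_min lexx.
have t's : t' <= s + d / 2 by rewrite ge_min lexx orbT.
exists ((s' + t') / 2); split; first by apply/andP; split; lra.
by apply: (close_in_interval (s := s') (t := t')) => //=; lra.
Qed.

Hypotheses (f_lnc : locally_nonconstant f) (f_lift : lifts_locators f).

(** Local nonconstancy supplies a real point; continuity keeps the sign of [f] at a nearby rational,
    which, unlike the real point, comes with a locator. *)
Lemma rational_apart_zero (p q : rat) : p < q ->
  exists w : rat, p < w < q /\ (lcut (f (drat w)) 0 \/ ucut (f (drat w)) 0).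
Proof.
move=> pq; have [|z [[p' [/= pp' Lp']] [q' [Uq' /= qq']]]] :=
    f_lnc (x := drat p) (y := drat q) (drat 0).
  by exists ((p + q) / 2) => /=; split; lra.
have {}Lp := lcut_lt pp' Lp'; have {}Uq := ucut_lt qq' Uq'.
case=> -[r [/= h1 h2]].
- have [d [d0 fd]] := continuous_neg (ucut_lt h2 h1).
  have [w [pwq /fd wU]] := rational_approx Lp Uq d0.
  by exists w; split; [|right].
- have [d [d0 fd]] := continuous_pos (lcut_lt h1 h2).
  have [w [pwq /fd wL]] := rational_approx Lp Uq d0.
  by exists w; split; [|left].
Qed.

Let f_locator (w : rat) : locator (f (drat w)) :=
  f_lift (@drat_locator w).

Lemma find_rational_apart_zero (p q : rat) : p < q ->
  {w : rat & p < w < q & {lcut (f (drat w)) 0} + {ucut (f (drat w)) 0}}.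
Proof.
move=> pq.
(* The search runs over pairs [(w, e)]: the rational [e] bounds [f w] away from zero, which forces
   the answer of the locator on the interval between [0] and [e]. *)
pose pos (w e : rat) := (0 < e) && located_below (@f_locator w) 0 e.
pose neg (w e : rat) := (e < 0) && ~~ located_below (@f_locator w) e 0.
have ex : exists we : rat * rat,
    (p < we.1 < q) && (pos we.1 we.2 || neg we.1 we.2).
  have [w [pwq [/lcut_round|/ucut_round] [e [e0 cut_e]]]] :=
      rational_apart_zero pq.
  - exists (w, e); rewrite /= pwq /pos e0 /=.
    by rewrite (lcut_located_below (@f_locator w) e0 cut_e).
  - exists (w, e); rewrite /= pwq /neg e0 /=.
    by rewrite (ucut_not_located_below (@f_locator w) _ cut_e) orbT.
case: (xchoose ex) (xchooseP ex) => w e /= /andP[pwq].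
case: (boolP (pos w e)) => [/andP[_ wL] _ | _ /= /andP[e0 wU]].
- by exists w => //; left; apply: located_below_lcut wL.
- by exists w => //; right; apply: not_located_below_ucut wU.
Qed.

(** * Brackets and their trisection *)

Record bracket := Bracket {
  lo : rat; hi : rat;
  left_end : dreal; right_end : dreal;
  left_loc : locator left_end;
  right_loc : locator right_end;
  lo_lt_left : lcut left_end lo;
  right_lt_hi : ucut right_end hi;
  left_lt_right : dlt left_end right_end;
  left_npos : ~ lcut (f left_end) 0;
  right_nneg : ~ ucut (f right_end) 0
}.

Definition width (B : bracket) : rat := hi B - lo B.

Lemma lo_lt_right B : lcut (right_end B) (lo B).
Proof.
have [q [Uq Lq]] := left_lt_right B.
exact: lcut_lt (cut_lt (lo_lt_left B) Uq) Lq.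
Qed.

Lemma left_lt_hi B : ucut (left_end B) (hi B).
Proof.
have [q [Uq Lq]] := left_lt_right B.
exact: ucut_lt (cut_lt Lq (right_lt_hi B)) Uq.
Qed.

Lemma lo_lt_hi B : lo B < hi B.
Proof. exact: cut_lt (lo_lt_left B) (left_lt_hi B). Qed.

Lemma refine_bracket (B : bracket) :
  {B' : bracket | [/\ lo B <= lo B', hi B' <= hi B & 3 * width B' <= 2 * width B]}.
Proof.
rewrite /width; have := lo_lt_hi B.
case: B => s t u v lu lv su vt uv fu fv /= st.
pose h := t - s; have h0 : 0 < h by rewrite /h; lra.
have Eh : h = t - s by [].
(* A locator query needs two distinct points. The slack [h / 9] on either side still leaves the gap
   from [4/9] to [5/9] for a new end point. *)
have [|Lu|Uu] := lu (s + h / 3) (s + h * (4 / 9)); first by lra.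
  by exists (Bracket lu lv Lu vt uv fu fv); split=> /=; lra.
have [|Lv|Uv] := lv (s + h * (5 / 9)) (s + h * (2 / 3)); first by lra.
  have [|z /andP[pz zq]] :=
    @find_rational_apart_zero (s + h * (4 / 9)) (s + h * (5 / 9)); first by lra.
  (* The sign of [f z] decides which end [z] replaces; either way [5/9 <= 2/3] of the length
     remains. *)
  case=> fz.
  - have zU : ~ ucut (f (drat z)) 0.
      by move=> U0; have := cut_lt fz U0; rewrite ltxx.
    have uz : dlt u (drat z) by exists (s + h * (4 / 9)).
    exists (@Bracket s (s + h * (5 / 9)) _ _ lu (@drat_locator z)
      su zq uz fu zU).
    by split=> /=; lra.
  - have zL : ~ lcut (f (drat z)) 0.
      by move=> L0; have := cut_lt L0 fz; rewrite ltxx.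
    have zv : dlt (drat z) v by exists (s + h * (5 / 9)).
    exists (@Bracket (s + h * (4 / 9)) t _ _ (@drat_locator z) lv
      pz vt zv zL fv).
    by split=> /=; lra.
by exists (Bracket lu lv su Uv uv fu fv); split=> /=; lra.
Qed.

(** * Convergence of the brackets to a root *)

Variable B0 : bracket.

Definition bracket_seq (n : nat) : bracket :=
  iter n (fun B => sval (refine_bracket B)) B0.

Lemma bracket_seqS n : [/\ lo (bracket_seq n) <= lo (bracket_seq n.+1),
  hi (bracket_seq n.+1) <= hi (bracket_seq n) &
  3 * width (bracket_seq n.+1) <= 2 * width (bracket_seq n)].
Proof. exact: svalP (refine_bracket (bracket_seq n)). Qed.

Lemma bracket_seq_mono m n : (m <= n)%N ->
  lo (bracket_seq m) <= lo (bracket_seq n) /\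
  hi (bracket_seq n) <= hi (bracket_seq m).
Proof.
move=> /subnKC <-; elim: (n - m)%N => [|k [IHl IHh]]; first by rewrite addn0.
rewrite addnS; have [hl hh _] := bracket_seqS (m + k).
by split; [apply: le_trans hl | apply: le_trans hh _].
Qed.

Lemma width_gt0 B : 0 < width B.
Proof. by rewrite subr_gt0 lo_lt_hi. Qed.

(* A linear bound suffices: [2/3 * (n + 3) <= n + 2]. *)
Lemma width_bracket_seq n : width (bracket_seq n) * (n%:R + 2) <= 2 * width B0.
Proof.
elim: n => [|n IHn]; first by rewrite add0r mulrC.
have [_ _ hw] := bracket_seqS n; apply: le_trans IHn.
have wS := width_gt0 (bracket_seq n.+1); have w0 := width_gt0 (bracket_seq n).
have n0 : 0 <= n%:R :> rat by apply: ler0n.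
rewrite -natr1; nra.
Qed.

Lemma width_small (e : rat) : 0 < e -> exists n, width (bracket_seq n) < e.
Proof.
move=> e0; have w0 := width_gt0 B0.
have q0 : 0 <= 2 * width B0 / e by rewrite divr_ge0 // ltW //; lra.
exists (Num.bound (2 * width B0 / e)); have := archi_boundP q0.
rewrite ltr_pdivrMr //; set n := Num.bound _ => hn.
have := width_bracket_seq n; have wn := width_gt0 (bracket_seq n).
have n0 : 0 <= n%:R :> rat by apply: ler0n.
(* A width of at least [e] would give [e * (n + 2) <= 2 * width B0 < n * e]. *)
move=> hw; rewrite ltNge; apply/negP => le_e; nra.
Qed.

Fact root_cut : is_dedekind (fun q => exists n, q < lo (bracket_seq n))
                            (fun r => exists n, hi (bracket_seq n) < r).
Proof.
split.
- split; first by exists (lo B0 - 1), 0%N => /=; lra.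
  by exists (hi B0 + 1), 0%N => /=; lra.
- split=> q; split.
  + case=> n h; exists ((q + lo (bracket_seq n)) / 2); split; first by lra.
    by exists n; lra.
  + by case=> q' [h [n h']]; exists n; apply: lt_trans h'.
  + case=> n h; exists ((q + hi (bracket_seq n)) / 2); split; first by lra.
    by exists n; lra.
  + by case=> q' [h [n h']]; exists n; apply: lt_trans h.
- move=> q r [m hm] [n hn].
  have [lm _] := bracket_seq_mono (leq_maxl m n).
  have [_ hn'] := bracket_seq_mono (leq_maxr m n).
  by have := lo_lt_hi (bracket_seq (maxn m n)); lra.
- move=> q r qr; have [|n] := @width_small (r - q); first by lra.
  rewrite /width => hn; case: (ltP q (lo (bracket_seq n))) => h.
    by left; exists n.
  by right; exists n; lra.
Qed.

Definition root : dreal := DReal root_cut.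

(** Comparing rational widths is decidable, so a sufficiently late bracket can be computed, and its
    [lo] decides between [q] and [r]. *)
Lemma root_locator : locator root.
Proof.
move=> q r qr; have ex : exists n, width (bracket_seq n) < r - q.
  by apply: width_small; lra.
case: (ex_minnP ex) => n; rewrite /width => hn _.
case: (ltP q (lo (bracket_seq n))) => h; first by left; exists n.
by right; exists n; lra.
Qed.

Lemma close_root (d : rat) : 0 < d -> exists n,
  ucut (dabs (dsub root (left_end (bracket_seq n)))) d /\
  ucut (dabs (dsub root (right_end (bracket_seq n)))) d.
Proof.
move=> d0; have [|n] := @width_small (d / 2); first by lra.
rewrite /width => hn; exists n; set B := bracket_seq n in hn *.
(* The limit may coincide with [lo B] or [hi B], so the interval is widened by [k] on both sides to
   get strict bounds; its length stays below [d / 2 + d / 4]. *)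
pose k := d / 8.
have k0 : 0 < k by rewrite /k; lra.
have Ls : lcut root (lo B - k) by exists n; rewrite -/B; lra.
have Ut : ucut root (hi B + k) by exists n; rewrite -/B; lra.
have sk : lo B - k < lo B by lra.
have tk : hi B < hi B + k by lra.
have kd : (hi B + k) - (lo B - k) < d by rewrite /k; lra.
split; apply: (close_in_interval kd Ls Ut).
- exact: lcut_lt sk (lo_lt_left B).
- exact: ucut_lt tk (left_lt_hi B).
- exact: lcut_lt sk (lo_lt_right B).
- exact: ucut_lt tk (right_lt_hi B).
Qed.

(** A strict sign of [f] at the limit would persist at nearby bracket ends: a positive one
    contradicts [left_npos], a negative one [right_nneg]. *)
Lemma root_eq0 : f root = drat 0.
Proof.
apply: eq_drat0.
- case/continuous_pos=> d [/close_root[n [cl _]] fd].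
  exact: left_npos (fd _ cl).
- case/continuous_neg=> d [/close_root[n [_ cr]] fd].
  exact: right_nneg (fd _ cr).
Qed.

End Root.

Theorem theorem4p16 (f : dreal -> dreal)
  (f_cont : pointwise_continuous f)
  (f_lnc : locally_nonconstant f)
  (f_lift : lifts_locators f)
  (a b : dreal)
  (a_lt_b : dlt a b)
  (a_loc : locator a) (b_loc : locator b)
  (fa_le0 : dle (f a) (drat 0%R))
  (fb_ge0 : dle (drat 0%R) (f b)) :
  {x : dreal & ((f x = drat 0%R) * locator x)%type}.
Proof.
have [s sa] := locator_lower_bound a_loc.
have [t bt] := locator_upper_bound b_loc.
have fa : ~ lcut (f a) 0 by move/dlt_drat0_lcut.
have fb : ~ ucut (f b) 0 by move/dlt_ucut_drat0.
pose B0 := Bracket a_loc b_loc sa bt a_lt_b fa fb.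
exists (root f_cont f_lnc f_lift B0); split; first exact: root_eq0.
exact: root_locator.
Qed.
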